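(* Assume perfect knowledge of the user's location $\psi$. Let $\mathbf{B}=[B_0,\dots,B_{N-1}]^\top\in\mathbb{C}^N$ be the vector of complex effective gains and let $R(\mathbf{a})$ be the user's achievable rate for the binary activation vector $\mathbf{a}\in\{0,1\}^N$, both as defined in the context. Then the problem of maximizing the rate $R(\mathbf{a})$ over $\mathbf{a}\in\{0,1\}^N$ can be written as a special case of a quadratic fractional 0-1 programming (QF01P) problem (defined in the context), and can be expressed as $$\max_{\mathbf{a}}\ \frac{\mathbf{a}^\top\mathbf{Q}\,\mathbf{a}}{\mathbf{1}^\top\mathbf{a}}\qquad\text{s.t.}\quad \mathbf{a}\in\{0,1\}^N,$$ with $$\mathbf{Q}=\Re\left(\mathbf{B}\mathbf{B}^H\right),$$ where the real part is taken entrywise, $\mathbf{B}^H$ is the conjugate transpose of $\mathbf{B}$, and $\mathbf{1}\in\mathbb{R}^N$ is the all-ones vector.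
   Context: System model. $N$ antennas are placed along a waveguide at height $H$, at the fixed positions $\psi^{\mathrm{Pin}}_n=\left(-D+\frac{2D}{N-1}n,\,0,\,H\right)$, $n=0,\dots,N-1$, where $D$ is the waveguide length parameter. One user is served at a time; it is located at $\psi=(x,y,z)$ with $x,y\in[-L,L]$ and $z\in[0,1]$. Let $\lambda$ be the free-space wavelength, $\lambda_g$ the wavelength in the waveguide, $P$ the transmit power, $\eta$ the path loss scaling factor and $\sigma_w^2$ the variance of the additive white Gaussian noise. With $\|\cdot\|$ the Euclidean norm and $j$ the imaginary unit, define for $n=0,\dots,N-1$ $$h_n=\frac{\exp\left(-j\frac{2\pi}{\lambda}\|\psi-\psi^{\mathrm{Pin}}_n\|\right)}{\|\psi-\psi^{\mathrm{Pin}}_n\|},\qquad \theta_n=\frac{2\pi}{\lambda_g}\|\psi^{\mathrm{Pin}}_n-\psi^{\mathrm{Pin}}_0\|,\qquad B_n=h_n e^{-j\theta_n}.$$ Rate. The activation vector is $\mathbf{a}=[a_0,\dots,a_{N-1}]^\top\in\{0,1\}^N$, where $a_n=1$ means that antenna $n$ is active; $\|\mathbf{a}\|_0$ denotes the number of nonzero entries of $\mathbf{a}$, i.e. the number of activated antennas, among which the power is divided equally. The received signal-to-noise ratio and the achievable rate are $$\gamma(\mathbf{a})=\frac{P\eta}{\|\mathbf{a}\|_0\,\sigma_w^2}\left|\mathbf{a}^\top\mathbf{B}\right|^2,\qquad R(\mathbf{a})=\log_2\left(1+\gamma(\mathbf{a})\right),$$ so that maximizing the rate is posed as $\max_{\mathbf{a}\in\{0,1\}^N}|\mathbf{a}^\top\mathbf{B}|^2/\|\mathbf{a}\|_0$.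 QF01P. A quadratic fractional 0-1 programming problem (a well-known class of nonconvex combinatorial optimization problems) has the general form $$\max_{\mathbf{x}}\ \frac{\mathbf{x}^\top \mathbf{M}\mathbf{x}+\mathbf{c}^\top\mathbf{x}+r}{\mathbf{x}^\top \mathbf{E}\mathbf{x}+\mathbf{d}^\top\mathbf{x}+s}\quad\text{s.t.}\quad \mathbf{x}\in\{0,1\}^n,\quad \mathbf{A}\mathbf{x}\le\mathbf{b},$$ where $\mathbf{x}$ is a binary decision vector, $\mathbf{M},\mathbf{E}$ are symmetric $n\times n$ matrices, $\mathbf{c},\mathbf{d}\in\mathbb{R}^n$, $r,s\in\mathbb{R}$ are constants, and $\mathbf{A}\in\mathbb{R}^{m\times n}$, $\mathbf{b}\in\mathbb{R}^m$ are optional linear constraint parameters. *)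

(* Defs.v *)
From mathcomp Require Import all_boot all_order all_algebra.
From mathcomp Require Import all_classical all_reals all_analysis.
From mathcomp Require Import complex.

Set Implicit Arguments.
Unset Strict Implicit.
Unset Printing Implicit Defensive.

Import Order.TTheory GRing.Theory Num.Theory.
Local Open Scope classical_set_scope.
Local Open Scope ring_scope.
Local Open Scope complex_scope.

Definition binary (R : realType) (n : nat) : set 'cV[R]_n :=
  [set a | forall i, a i 0 = 0 \/ a i 0 = 1].
Arguments binary R n : clear implicits.

Definition argmax (R : realType) (T : Type) (S : set T) (f : T -> R) : set T :=
  [set a | S a /\ forall b, S b -> f b <= f a].

(* Quadratic form, linear form: a 1 x 1 matrix product read as a scalar. *)
Definition qform (R : realType) (n : nat) (M : 'M[R]_n) (x : 'cV[R]_n) : R :=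
  (x^T *m M *m x) 0 0.

Definition lform (R : realType) (n : nat) (c x : 'cV[R]_n) : R :=
  (c^T *m x) 0 0.

(* Data of a quadratic fractional 0-1 program with n variables and m linear
   constraints; m = 0 is the case without linear constraints. *)
Record qf01p (R : realType) (m n : nat) := QF01P {
  qM : 'M[R]_n;
  qc : 'cV[R]_n;
  qr : R;
  qE : 'M[R]_n;
  qd : 'cV[R]_n;
  qs : R;
  qA : 'M[R]_(m, n);
  qb : 'cV[R]_m;
  qM_sym : qM^T = qM;
  qE_sym : qE^T = qE
}.

Definition qf01p_feasible (R : realType) (m n : nat) (q : qf01p R m n) :
    set 'cV[R]_n :=
  binary R n `&` [set x | forall i, (qA q *m x) i 0 <= qb q i 0].

(* Where the denominator vanishes the quotient is 0, since x / 0 = 0. *)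
Definition qf01p_objective (R : realType) (m n : nat) (q : qf01p R m n)
    (x : 'cV[R]_n) : R :=
  (qform (qM q) x + lform (qc q) x + qr q) /
  (qform (qE q) x + lform (qd q) x + qs q).

Definition vec3 (R : realType) (x y z : R) : 'rV[R]_3 :=
  \row_(i < 3) [:: x; y; z]`_i.

(* The library norm on matrices is the sup norm, hence this definition. *)
Definition enorm (R : realType) (n : nat) (v : 'rV[R]_n) : R :=
  Num.sqrt (\sum_(i < n) v 0 i ^+ 2).

Definition cexp (R : realType) (z : R[i]) : R[i] :=
  (expR (complex.Re z))%:C * (cos (complex.Im z) +i* sin (complex.Im z)).

Definition log2 (R : realType) (x : R) : R := ln x / ln 2.

Definition antenna_pos (R : realType) (N : nat) (D H : R) (n : nat) : 'rV[R]_3 :=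
  vec3 (- D + 2 * D / (N%:R - 1) * n%:R) 0 H.

Definition channel (R : realType) (N : nat) (D H lambda : R) (psi : 'rV[R]_3)
    (n : nat) : R[i] :=
  let dist := enorm (psi - antenna_pos N D H n) in
  cexp (- 'i%C * (2 * pi / lambda * dist)%:C) / dist%:C.

Definition guide_phase (R : realType) (N : nat) (D H lambda_g : R) (n : nat) : R :=
  2 * pi / lambda_g * enorm (antenna_pos N D H n - antenna_pos N D H 0).

Definition gain_vec (R : realType) (N : nat) (D H lambda lambda_g : R)
    (psi : 'rV[R]_3) : 'cV[R[i]]_N :=
  \col_(n < N) (channel N D H lambda psi n *
                cexp (- 'i%C * (guide_phase N D H lambda_g n)%:C)).

Definition norm0 (R : realType) (n : nat) (a : 'cV[R]_n) : nat :=
  #|[set i : 'I_n | a i 0 != 0]%SET|.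

(* If no antenna is active then both norm0 a and a^T B vanish, and the
   convention x / 0 = 0 makes the signal-to-noise ratio, hence the rate, 0. *)
Definition snr (R : realType) (N : nat) (P eta sigma_w : R) (B : 'cV[R[i]]_N)
    (a : 'cV[R]_N) : R :=
  P * eta / ((norm0 a)%:R * sigma_w ^+ 2) *
  Normc.normc (((map_mx (real_complex R) a)^T *m B) 0 0) ^+ 2.

Definition rate (R : realType) (N : nat) (P eta sigma_w : R) (B : 'cV[R[i]]_N)
    (a : 'cV[R]_N) : R :=
  log2 (1 + snr P eta sigma_w B a).

Definition conj_tr (R : realType) (m n : nat) (B : 'M[R[i]]_(m, n)) :
    'M[R[i]]_(n, m) :=
  (map_mx (fun z : R[i] => z^*) B)^T.

Definition Re_mx (R : realType) (m n : nat) (B : 'M[R[i]]_(m, n)) : 'M[R]_(m, n) :=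
  map_mx (@complex.Re R) B.

(* Main.v *)
Require Import Defs.
From mathcomp Require Import all_boot all_order all_algebra.
From mathcomp Require Import all_classical all_reals all_analysis.
From mathcomp Require Import complex.

Set Implicit Arguments.
Unset Strict Implicit.
Unset Printing Implicit Defensive.

Import Order.TTheory GRing.Theory Num.Theory.
Local Open Scope classical_set_scope.
Local Open Scope ring_scope.

(** For real [a], [a^T Re(B B^H) a = (a^T Re B)^2 + (a^T Im B)^2 = |a^T B|^2],
    and for binary [a] the number of nonzero entries is [1^T a]. So the rate is
    an increasing function of the nonnegative ratio, and both have the same
    maximizers on every set of binary vectors. *)

Lemma complex_Re_sum (R : realType) (I : finType) (F : I -> R[i]) :
  complex.Re (\sum_i F i) = \sum_i complex.Re (F i).
Proof. exact: (raddf_sum (@complex.Re R)). Qed.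

Lemma complex_Im_sum (R : realType) (I : finType) (F : I -> R[i]) :
  complex.Im (\sum_i F i) = \sum_i complex.Im (F i).
Proof. exact: (raddf_sum (@complex.Im R)). Qed.

Lemma normc_sqr (R : realType) (w : R[i]) :
  Normc.normc w ^+ 2 = complex.Re w ^+ 2 + complex.Im w ^+ 2.
Proof. by case: w => u v; rewrite /= sqr_sqrtr // addr_ge0 ?sqr_ge0. Qed.

Lemma qformE (R : realType) (n : nat) (M : 'M[R]_n) (a : 'cV[R]_n) :
  qform M a = \sum_j \sum_i a i 0 * M i j * a j 0.
Proof.
rewrite /qform mxE; apply: eq_bigr => j _; rewrite mxE mulr_suml.
by apply: eq_bigr => i _; rewrite mxE.
Qed.

(** Conjugation flips the sign of the second imaginary part, so [Q] is the sum of two real rank-one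
    Gram matrices. Symmetry and the sum-of-squares form both follow from this. *)
Lemma Re_gramE (R : realType) (n : nat) (B : 'cV[R[i]]_n) i j :
  Re_mx (B *m conj_tr B) i j =
  complex.Re (B i 0) * complex.Re (B j 0) +
  complex.Im (B i 0) * complex.Im (B j 0).
Proof.
rewrite !mxE big_ord1 !mxE.
by case: (B i 0) (B j 0) => [u v] [u' v'] /=; rewrite mulrN opprK.
Qed.

Lemma Re_gram_sym (R : realType) (n : nat) (B : 'cV[R[i]]_n) :
  (Re_mx (B *m conj_tr B))^T = Re_mx (B *m conj_tr B).
Proof.
apply/matrixP => i j; rewrite mxE !Re_gramE.
by congr (_ + _); rewrite mulrC.
Qed.

Lemma qform_Re_gram (R : realType) (n : nat) (B : 'cV[R[i]]_n) (a : 'cV[R]_n) :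
  qform (Re_mx (B *m conj_tr B)) a =
  Normc.normc (((map_mx (real_complex R) a)^T *m B) 0 0) ^+ 2.
Proof.
rewrite normc_sqr mxE complex_Re_sum complex_Im_sum qformE.
have ReE i : complex.Re ((map_mx (real_complex R) a)^T 0 i * B i 0) =
    a i 0 * complex.Re (B i 0).
  by rewrite !mxE; case: (B i 0) => u v /=; rewrite mul0r subr0.
have ImE i : complex.Im ((map_mx (real_complex R) a)^T 0 i * B i 0) =
    a i 0 * complex.Im (B i 0).
  by rewrite !mxE; case: (B i 0) => u v /=; rewrite mul0r addr0.
rewrite (eq_bigr _ (fun i _ => ReE i)) (eq_bigr _ (fun i _ => ImE i)).
(* Expanding the right factor of each square first makes [j] the outer index, as in [qformE]. *)
rewrite !expr2 !mulr_sumr -big_split /=; apply: eq_bigr => j _.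
rewrite !mulr_suml -big_split /=; apply: eq_bigr => i _.
by rewrite Re_gramE mulrDr mulrDl !mulrA; congr (_ + _); rewrite mulrAC.
Qed.

(** An entry that is 0 or 1 equals the indicator of its being nonzero. *)
Lemma lform_ones_binary (R : realType) (n : nat) (a : 'cV[R]_n) :
  binary R n a -> lform (const_mx 1) a = (norm0 a)%:R.
Proof.
move=> a01; rewrite /lform /norm0 mxE -sum1_card natr_sum.
rewrite [RHS]big_mkcond /=; apply: eq_bigr => i _; rewrite !mxE mul1r inE.
by case: (a01 i) => ->; rewrite ?eqxx ?oner_eq0.
Qed.

Lemma ler_log2 (R : realType) (s t : R) :
  0 < s -> 0 < t -> (log2 s <= log2 t) = (s <= t).
Proof.
move=> s0 t0; rewrite /log2 ler_pM2r ?ler_ln//.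
by rewrite invr_gt0 ln_gt0// ltr1n.
Qed.

(** Maximizers depend only on the preorder that the objective induces on [S]. *)
Lemma eq_argmax (R : realType) (T : Type) (S : set T) (f g : T -> R) :
  (forall a b, S a -> S b -> (f a <= f b) = (g a <= g b)) ->
  argmax S f = argmax S g.
Proof.
move=> fg; apply/seteqP; split=> a [Sa amax]; split=> // b Sb.
  by rewrite -fg//; exact: amax.
by rewrite fg//; exact: amax.
Qed.

Lemma rate_ratio (R : realType) (n : nat) (P eta sigma_w : R)
    (B : 'cV[R[i]]_n) (a : 'cV[R]_n) : binary R n a ->
  rate P eta sigma_w B a =
  log2 (1 + P * eta / sigma_w ^+ 2 *
    (qform (Re_mx (B *m conj_tr B)) a / lform (const_mx 1) a)).
Proof.
move=> a01; rewrite /rate /snr qform_Re_gram (lform_ones_binary a01).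
(* [invfM] also covers a zero factor, so [a = 0] takes no separate case: both quotients are then
   0. *)
rewrite invfM -!mulrA; congr (log2 (1 + P * (eta * _))).
by rewrite mulrCA [_%:R^-1 * _]mulrC -mulrA.
Qed.

(** This keeps the argument of [log2] in the rate positive, where [log2] is increasing. *)
Lemma ratio_ge0 (R : realType) (n : nat) (B : 'cV[R[i]]_n) (a : 'cV[R]_n) :
  binary R n a ->
  0 <= qform (Re_mx (B *m conj_tr B)) a / lform (const_mx 1) a.
Proof.
move=> a01; rewrite qform_Re_gram (lform_ones_binary a01).
by rewrite divr_ge0 ?sqr_ge0 ?ler0n.
Qed.

Lemma ler_rate (R : realType) (n : nat) (P eta sigma_w : R)
    (B : 'cV[R[i]]_n) (a b : 'cV[R]_n) :
  0 < P -> 0 < eta -> 0 < sigma_w -> binary R n a -> binary R n b ->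
  (rate P eta sigma_w B a <= rate P eta sigma_w B b) =
  (qform (Re_mx (B *m conj_tr B)) a / lform (const_mx 1) a <=
   qform (Re_mx (B *m conj_tr B)) b / lform (const_mx 1) b).
Proof.
move=> P0 eta0 sigma0 a01 b01.
have k0 : 0 < P * eta / sigma_w ^+ 2 by rewrite divr_gt0 ?mulr_gt0 ?exprn_gt0.
rewrite !rate_ratio// ler_log2 ?lerD2l ?ler_pM2l//;
  by rewrite ltr_pwDl// mulr_ge0 ?(ltW k0)// ratio_ge0.
Qed.

(** The maximizers are compared twice: over all binary vectors, where the zero vector gets the value
    0 by the convention [x / 0 = 0], and over the nonzero ones, where the denominator is
    positive. *)
Theorem mainTheorem1 (R : realType) (N : nat)
    (D H L lambda lambda_g P eta sigma_w x y z : R)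
    (hN : (2 <= N)%N) (hD : 0 < D)
    (hlambda : 0 < lambda) (hlambda_g : 0 < lambda_g)
    (hP : 0 < P) (heta : 0 < eta) (hsigma : 0 < sigma_w)
    (hx : - L <= x <= L) (hy : - L <= y <= L) (hz : 0 <= z <= 1) :
  let psi := vec3 x y z in
  let B := gain_vec N D H lambda lambda_g psi in
  let Q := Re_mx (B *m conj_tr B) in
  let ones : 'cV[R]_N := const_mx 1 in
  let Rate := rate P eta sigma_w B in
  let ratio := fun a : 'cV[R]_N => qform Q a / lform ones a in
  exists q : qf01p R 0 N,
    [/\ qM q = Q, qc q = 0 & qr q = 0] /\
    [/\ qE q = 0, qd q = ones & qs q = 0] /\
    qf01p_feasible q = binary R N /\
    (forall a, qf01p_objective q a = ratio a) /\
    (forall a, binary R N a ->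
       Rate a = log2 (1 + P * eta / sigma_w ^+ 2 * ratio a)) /\
    argmax (binary R N) Rate = argmax (binary R N) ratio /\
    argmax (binary R N `\ 0) Rate = argmax (binary R N `\ 0) ratio.
Proof.
move=> psi B Q ones Rate ratio.
(* The numerator is purely quadratic, the denominator purely linear, and the constraint system has
   no rows. *)
exists (@QF01P R 0 N Q 0 0 0 ones 0 0 0 (Re_gram_sym B) (trmx0 _ _ _)).
split; first by [].
split; first by [].
(* The constraints are indexed by the empty type ['I_0], hence hold vacuously. *)
split; first by apply/seteqP; split=> [a [] //|a a01]; split=> // -[].
split.
  move=> a; rewrite /qf01p_objective /= /ratio.
  have -> : lform (0 : 'cV[R]_N) a = 0 by rewrite /lform trmx0 mul0mx mxE.
  have -> : qform (0 : 'M[R]_N) a = 0 by rewrite /qform mulmx0 mul0mx mxE.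
  by rewrite !addr0 add0r.
split; first by move=> a; exact: rate_ratio.
by split; apply: eq_argmax => a b; [|move=> [+ _] [+ _]]; exact: ler_rate.
Qed.
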